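(* For any integers $d\geq 3$ and $k\geq 4$, there exist two $d$-dimensional polytopes (in $\mathbb{R}^d$), both of diameter $2$, whose Minkowski sum has diameter $k$.
   Context: The Minkowski sum of $P$ and $Q$ is $P+Q=\{p+q : p\in P,\ q\in Q\}$. The diameter of a polytope is the diameter of its graph (the graph made up of its vertices and edges), i.e. the largest graph distance between two of its vertices. *)

(* Defs.v *)
From HB Require Import structures.
From mathcomp Require Import all_boot all_order all_algebra.
From mathcomp Require Import boolp classical_sets reals.

Set Implicit Arguments.
Unset Strict Implicit.
Unset Printing Implicit Defensive.

Import Order.TTheory GRing.Theory Num.Theory.
Local Open Scope classical_set_scope.
Local Open Scope ring_scope.

Section Polytopes.
Context {R : realType} {d : nat}.
Implicit Types (P Q F A : set 'rV[R]_d) (u v : 'rV[R]_d).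

Definition convex_hull n (p : 'I_n -> 'rV[R]_d) : set 'rV[R]_d :=
  [set x | exists w : 'I_n -> R,
     [/\ forall i, 0 <= w i, \sum_(i < n) w i = 1
       & x = \sum_(i < n) w i *: p i]].

Definition is_polytope P : Prop :=
  exists n (p : 'I_n -> 'rV[R]_d), P = convex_hull p.

(* U is the direction of the affine hull of A, i.e. the linear span of the
   differences of points of A. *)
Definition is_direction A (U : {vspace 'rV[R]_d}) : Prop :=
  (forall x y, A x -> A y -> x - y \in U) /\
  (forall V : {vspace 'rV[R]_d},
     (forall x y, A x -> A y -> x - y \in V) -> (U <= V)%VS).

Definition has_dim A (n : nat) : Prop :=
  A !=set0 /\ exists2 U : {vspace 'rV[R]_d}, is_direction A U & \dim U = n.

Definition minkowski_sum P Q : set 'rV[R]_d :=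
  [set p + q | p in P & q in Q].

Definition dotp u v : R := \sum_(i < d) u 0 i * v 0 i.

(* The faces of P are cut out by its valid inequalities; c = 0 gives P itself
   (b = 0) and the empty face (b = 1). *)
Definition is_face P F : Prop :=
  exists (c : 'rV[R]_d) (b : R),
    (forall x, P x -> dotp c x <= b) /\ F = [set x | P x /\ dotp c x = b].

Definition is_vertex P v : Prop := is_face P [set v].

Definition is_edge P F : Prop := is_face P F /\ has_dim F 1%N.

Definition adjacent P u v : Prop :=
  [/\ u <> v, is_vertex P u, is_vertex P v
    & exists F, [/\ is_edge P F, F u & F v]].

Definition walk P (n : nat) u v : Prop :=
  exists s : seq 'rV[R]_d,
    [/\ path (fun x y => `[< adjacent P x y >]) u s, last u s = v & size s = n].

Definition graph_dist P u v (n : nat) : Prop :=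
  walk P n u v /\ (forall m, walk P m u v -> (n <= m)%N).

Definition has_diameter P (k : nat) : Prop :=
  (forall u v, is_vertex P u -> is_vertex P v ->
     exists2 n, graph_dist P u v n & (n <= k)%N) /\
  (exists u v, [/\ is_vertex P u, is_vertex P v & graph_dist P u v k]).

End Polytopes.

(* Main.v *)
Require Import Defs.
From mathcomp Require Import all_boot all_order all_algebra.
From mathcomp Require Import boolp classical_sets reals.
From mathcomp Require Import ring lra zify.

(** Let B be a polytope of dimension d - 1 with 0 in its interior.  The pyramids
    over B x {0} with apexes (0, 1) and (0, -1) have diameter 2, because every
    vertex is joined to the apex.  Their Minkowski sum is the hull of 2B x {0}
    and B x {1, -1}, a bipyramid over 2B truncated at both apexes; every edge
    of it either stays in one of the three layers, where it is an edge of B, or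
    joins two copies of a vertex of B in consecutive layers.  Its diameter is
    therefore 2 more than that of B.

    For B we stack L = k - 2 scaled copies of a (d - 2)-simplex with vertices
    delta_i and barycentre 0: the vertices are (r_t delta_i, h_t), where h_t is
    equally spaced and r_t a strictly concave positive function of h_t.  An edge
    of B changes only one of i and t, and t by at most one, so the diameter is at
    least (L - 1) + 1.  Conversely one can always change i on the bottom or on
    the top copy, and the lengths of these two routes add up to 2L. *)

Set Implicit Arguments.
Unset Strict Implicit.
Unset Printing Implicit Defensive.

Import Order.TTheory GRing.Theory Num.Theory.
Local Open Scope classical_set_scope.
Local Open Scope ring_scope.

(** * Hulls of exposed generators *)

Section DotProduct.
Context {R : realType} {d : nat}.
Implicit Types (u v c : 'rV[R]_d).

Lemma dotpDr c u v : dotp c (u + v) = dotp c u + dotp c v.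
Proof. by rewrite /dotp -big_split; apply: eq_bigr => i _; rewrite mxE mulrDr. Qed.

Lemma dotpZr c (a : R) u : dotp c (a *: u) = a * dotp c u.
Proof. by rewrite /dotp mulr_sumr; apply: eq_bigr => i _; rewrite mxE mulrCA. Qed.

Lemma dotp0r c : dotp c 0 = 0.
Proof. by rewrite /dotp big1 // => i _; rewrite mxE mulr0. Qed.

Lemma dotp_sumr (K : finType) c (x : K -> 'rV[R]_d) :
  dotp c (\sum_k x k) = \sum_k dotp c (x k).
Proof. by apply: (big_morph _ (dotpDr c) (dotp0r c)). Qed.

Lemma dotp_comb (K : finType) c (w : K -> R) (x : K -> 'rV[R]_d) :
  dotp c (\sum_k w k *: x k) = \sum_k w k * dotp c (x k).
Proof. by rewrite dotp_sumr; apply: eq_bigr => k _; rewrite dotpZr. Qed.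

End DotProduct.

Lemma dotp_row_mx (R : realType) (d1 d2 : nat) (c1 u1 : 'rV[R]_d1)
    (c2 u2 : 'rV[R]_d2) :
  dotp (row_mx c1 c2) (row_mx u1 u2) = dotp c1 u1 + dotp c2 u2.
Proof.
rewrite /dotp big_split_ord /=; congr (_ + _); apply: eq_bigr => i _.
  by rewrite !row_mxEl.
by rewrite !row_mxEr.
Qed.

(** * Walks and distances in the graph of a polytope *)

Section Walks.
Context {R : realType} {d : nat} (P : set 'rV[R]_d).
Implicit Types (u v w : 'rV[R]_d).

Lemma adjacent_sym u v : adjacent P u v -> adjacent P v u.
Proof.
move=> [uv Vu Vv [F [eF Fu Fv]]]; split=> //; first exact/nesym.
by exists F; split.
Qed.

Lemma walk0 u : walk P 0 u u.
Proof. by exists [::]. Qed.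

Lemma walk1 u v : adjacent P u v -> walk P 1 u v.
Proof. by move=> uv; exists [:: v]; split=> //=; rewrite andbT; apply/asboolP. Qed.

Lemma walk_trans m n u v w : walk P m u v -> walk P n v w -> walk P (m + n) u w.
Proof.
move=> [s [ps <- <-]] [s' [ps' <- <-]].
by exists (s ++ s'); rewrite cat_path ps ps' last_cat size_cat.
Qed.

Lemma walkS n u w : walk P n.+1 u w -> exists2 v, adjacent P u v & walk P n v w.
Proof.
move=> [[|v s] [//= /andP[/asboolP uv ps] lst [sz]]].
by exists v => //; exists s.
Qed.

Lemma walk_sym n u v : walk P n u v -> walk P n v u.
Proof.
elim: n u => [|n IH] u; first by move=> [[|? ?] [//= _ <- _]]; exact: walk0.
move=> /walkS[x /adjacent_sym/walk1 xu /IH vx].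
by rewrite -addn1; exact: walk_trans vx xu.
Qed.

Lemma walk_dist n u v : walk P n u v -> exists2 m, graph_dist P u v m & (m <= n)%N.
Proof.
move=> uv.
have ex : exists m, `[< walk P m u v >] by exists n; apply/asboolP.
case: (ex_minnP ex) => m /asboolP wm min_m.
exists m; last by apply: min_m; apply/asboolP.
by split=> // m' wm'; apply: min_m; apply/asboolP.
Qed.

End Walks.

Section Peak.
Context {R : realType} {J : finType} (v : J -> R) (b : R) (S : {pred J}).

(** Stated for arbitrary values, so that it serves both functionals on generators ([exposes]) and
    the function [level] on the indices of the base. *)
Definition peak : Prop := forall j, if j \in S then v j = b else v j < b.

Lemma peak_le : peak -> forall j, v j <= b.
Proof. by move=> h j; have := h j; case: ifP => _ => [->|/ltW]. Qed.

Lemma peak_notin j : peak -> j \notin S -> v j < b.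
Proof. by move=> h jS; have := h j; rewrite (negPf jS). Qed.

Lemma peak_in j : peak -> j \in S -> v j = b.
Proof. by move=> h jS; have := h j; rewrite jS. Qed.

End Peak.

(** * Vertices and edges of a hull, read off its generators *)

Section Hull.
Context {R : realType} {d : nat} {J : finType} (p : J -> 'rV[R]_d).

Definition hull : set 'rV[R]_d :=
  [set x | exists w : J -> R,
     [/\ forall j, 0 <= w j, \sum_j w j = 1 & x = \sum_j w j *: p j]].

Lemma hull_polytope : is_polytope hull.
Proof.
exists #|J|, (p \o enum_val); apply/seteqP; split=> x [w [w0 w1 ->]].
  exists (w \o enum_val); split=> [i|//|]; first exact: w0.
    by rewrite -w1 [RHS](reindex (@enum_val J J)) //; apply: onW_bij; apply: enum_val_bij.
  by rewrite [LHS](reindex (@enum_val J J)) //; apply: onW_bij; apply: enum_val_bij.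
exists (w \o enum_rank); split=> [i|//|]; first exact: w0.
  by rewrite -w1 [RHS](reindex (@enum_rank J)) //; apply: onW_bij; apply: enum_rank_bij.
rewrite [LHS](reindex (@enum_rank J)) /=; last by apply: onW_bij; apply: enum_rank_bij.
by apply: eq_bigr => j _; rewrite enum_rankK.
Qed.

Lemma hull_gen j : hull (p j).
Proof.
exists (fun k => (k == j)%:R); split=> [k||]; first exact: ler0n.
  by rewrite (bigD1 j) //= eqxx big1 ?addr0 // => k /negPf->.
rewrite (bigD1 j) //= eqxx scale1r big1 ?addr0 // => k /negPf->.
by rewrite scale0r.
Qed.

Lemma hull_comb (K : finType) (w : K -> R) (x : K -> 'rV[R]_d) :
  (forall k, 0 <= w k) -> \sum_k w k = 1 -> (forall k, hull (x k)) ->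
  hull (\sum_k w k *: x k).
Proof.
move=> w0 w1 hx; have [W HW] := choice hx.
exists (fun j => \sum_k w k * W k j); split.
- by move=> j; apply: sumr_ge0 => k _; apply: mulr_ge0 => //; case: (HW k).
- rewrite exchange_big /= -w1; apply: eq_bigr => k _.
  by rewrite -mulr_sumr; case: (HW k) => _ -> _; rewrite mulr1.
- under [RHS]eq_bigr => j _ do rewrite scaler_suml.
  rewrite exchange_big /=; apply: eq_bigr => k _; case: (HW k) => _ _ {1}->.
  by rewrite scaler_sumr; apply: eq_bigr => j _; rewrite scalerA.
Qed.

Lemma hull_midpoint x y : hull x -> hull y -> hull (2^-1 *: x + 2^-1 *: y).
Proof.
move=> hx hy.
have -> : 2^-1 *: x + 2^-1 *: y = \sum_(b : bool) 2^-1 *: (if b then x else y).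
  by rewrite big_bool.
apply: hull_comb => [k||[]//]; first by rewrite invr_ge0.
by rewrite big_bool /=; lra.
Qed.

Lemma hull_le c b x : (forall j, dotp c (p j) <= b) -> hull x -> dotp c x <= b.
Proof.
move=> le_b [w [w0 w1 ->]]; rewrite dotp_comb -[b]mul1r -w1 mulr_suml.
by apply: ler_sum => j _; apply: ler_wpM2l.
Qed.

(** The terms [w k * (b - dotp c (p k))] are nonnegative and sum to zero, so each vanishes. *)
Lemma hull_face_support c b (w : J -> R) :
  (forall j, dotp c (p j) <= b) -> (forall j, 0 <= w j) -> \sum_j w j = 1 ->
  dotp c (\sum_j w j *: p j) = b -> forall j, w j != 0 -> dotp c (p j) = b.
Proof.
move=> le_b w0 w1 cb j wj.
have pos k : 0 <= w k * (b - dotp c (p k)) by rewrite mulr_ge0 ?subr_ge0.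
have /eqP : \sum_k w k * (b - dotp c (p k)) = 0.
  under eq_bigr => k _ do rewrite mulrBr.
  by rewrite sumrB -mulr_suml w1 -dotp_comb cb mul1r subrr.
rewrite psumr_eq0 => [/allP/(_ j)|//]; rewrite mem_index_enum => /(_ isT) /=.
by rewrite mulf_eq0 (negPf wj) subr_eq0 /= => /eqP.
Qed.

Definition exposes c b (S : {pred J}) : Prop := peak (fun j => dotp c (p j)) b S.

Lemma exposes_le c b S : exposes c b S -> forall j, dotp c (p j) <= b.
Proof. exact: peak_le. Qed.

Lemma exposes_notin c b S j : exposes c b S -> j \notin S -> dotp c (p j) < b.
Proof. exact: peak_notin. Qed.

Lemma exposes_in c b S j : exposes c b S -> j \in S -> dotp c (p j) = b.
Proof. exact: peak_in. Qed.

Lemma exposes_support c b S (w : J -> R) : exposes c b S ->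
  (forall j, 0 <= w j) -> \sum_j w j = 1 ->
  dotp c (\sum_j w j *: p j) = b -> forall j, j \notin S -> w j = 0.
Proof.
move=> h w0 w1 cb j jS; apply/eqP; apply: contraT => wj.
have := hull_face_support (exposes_le h) w0 w1 cb wj.
by have := exposes_notin h jS => /[swap] ->; rewrite ltxx.
Qed.

Lemma exposes_vertex c b j : exposes c b (pred1 j) -> is_vertex hull (p j).
Proof.
move=> h; exists c, b; split.
  by move=> x; apply: hull_le; exact: exposes_le h.
apply/seteqP; split=> [x ->|x [[w [w0 w1 ->]] cb]].
  by split; [exact: hull_gen | apply: (exposes_in h); rewrite inE].
have wS k : k != j -> w k = 0.
  by move=> kj; apply: (exposes_support h w0 w1 cb); rewrite inE.
rewrite /= (bigD1 j) //= big1 => [|k /wS->]; last by rewrite scale0r.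
move: w1; rewrite (bigD1 j) //= big1 => [|k /wS->//].
by rewrite !addr0 => ->; rewrite scale1r.
Qed.

(** A generator of nonzero weight in [v] lies on every face through [v], in particular on
    [[set v]]. *)
Lemma vertex_gen v : is_vertex hull v -> exists j, v = p j.
Proof.
move=> [c [b [le_b Fv]]].
have [/= hv cb] : hull v /\ dotp c v = b.
  by have : [set v] v by []; rewrite Fv.
move: hv => [w [w0 w1 ev]].
have [j wj] : exists j, w j != 0.
  apply: contrapT => /forallNP w_eq0; move: w1; rewrite big1 => [/eqP|j _].
    by rewrite eq_sym oner_eq0.
  by apply/eqP; apply: contraT => /w_eq0.
exists j; suff : [set v] (p j) by move=> /= ->.
rewrite Fv; split; first exact: hull_gen.
apply: hull_face_support wj => //; last by rewrite -ev.
by move=> k; apply: le_b; exact: hull_gen.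
Qed.

Hypothesis exposed_gen : forall j, exists c b, exposes c b (pred1 j).

Lemma gen_vertex j : is_vertex hull (p j).
Proof. by have [c [b]] := exposed_gen j; exact: exposes_vertex. Qed.

Lemma gen_inj : injective p.
Proof.
move=> j k pjk; apply/eqP; apply: contraT => jk.
have [c [b h]] := exposed_gen j.
have := exposes_notin h (j := k); rewrite inE eq_sym => /(_ jk).
by rewrite -pjk (exposes_in h) ?inE // ltxx.
Qed.

(** The weights of a point of the face vanish off [j] and [k], so the face lies on the line through
    [p j] and [p k]. *)
Lemma exposes_adjacent c b j k :
  exposes c b (pred2 j k) -> j != k -> adjacent hull (p j) (p k).
Proof.
move=> h jk; split.
- by move=> /gen_inj/eqP; rewrite (negPf jk).
- exact: gen_vertex.
- exact: gen_vertex.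
have cj : dotp c (p j) = b by apply: (exposes_in h); rewrite !inE eqxx.
have ck : dotp c (p k) = b by apply: (exposes_in h); rewrite !inE eqxx orbT.
pose F : set 'rV[R]_d := [set x | hull x /\ dotp c x = b].
have Fj : F (p j) by split=> //; exact: hull_gen.
have Fk : F (p k) by split=> //; exact: hull_gen.
exists F; split=> //; split.
  by exists c, b; split=> // x; apply: hull_le; exact: exposes_le h.
split; first by exists (p j).
have seg x : F x -> exists a : R, x = p k + a *: (p j - p k).
  move=> [[w [w0 w1 ->]] cb]; exists (w j).
  have wS i : i != j -> i != k -> w i = 0.
    move=> ij ik; apply: (exposes_support h w0 w1 cb).
    by rewrite !inE negb_or ij ik.
  have kj : k != j by rewrite eq_sym.
  move: w1; rewrite (bigD1 j) //= (bigD1 k) //= big1 => [|i /andP[]]; last exact: wS.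
  rewrite (bigD1 j) //= (bigD1 k) //= [\sum_(i | _) _ *: _]big1; last first.
    by move=> i /andP[ij ik]; rewrite wS // scale0r.
  rewrite !addr0 => w1; have -> : w k = 1 - w j by lra.
  by rewrite scalerBl scale1r scalerBr addrC addrAC -addrA.
exists <[p j - p k]>%VS; last first.
  rewrite dim_vline; case: eqP => // /eqP; rewrite subr_eq0 => /eqP/gen_inj/eqP.
  by rewrite (negPf jk).
split=> [x y /seg[a ->] /seg[a' ->]|V HV].
  apply/vlineP; exists (a - a').
  by rewrite opprD addrACA subrr add0r scalerBl.
by rewrite -memvE; apply: HV.
Qed.

(** One of three collinear points lies between the others and cannot be exposed alone: [p k] if
    [a < 0], [p j] if [a > 1], [p l] otherwise. *)
Lemma vertices_not_collinear j k l (a : R) : j != k -> l != j -> l != k ->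
  p l <> p k + a *: (p j - p k).
Proof.
move=> jk lj lk pl.
have dpl c : dotp c (p l) = (1 - a) * dotp c (p k) + a * dotp c (p j).
  by rewrite pl dotpDr dotpZr dotpDr -scaleN1r dotpZr; ring.
have [cl [bl hl]] := exposed_gen l.
have [cj [bj hj]] := exposed_gen j.
have [ck [bk hk]] := exposed_gen k.
have ll : dotp cl (p l) = bl by apply: (exposes_in hl); rewrite inE.
have jj : dotp cj (p j) = bj by apply: (exposes_in hj); rewrite inE.
have kk : dotp ck (p k) = bk by apply: (exposes_in hk); rewrite inE.
have lj' : dotp cl (p j) < bl by apply: (exposes_notin hl); rewrite inE eq_sym.
have lk' : dotp cl (p k) < bl by apply: (exposes_notin hl); rewrite inE eq_sym.
have jl' : dotp cj (p l) < bj by apply: (exposes_notin hj); rewrite inE.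
have jk' : dotp cj (p k) < bj by apply: (exposes_notin hj); rewrite inE eq_sym.
have kl' : dotp ck (p l) < bk by apply: (exposes_notin hk); rewrite inE.
have kj' : dotp ck (p j) < bk by apply: (exposes_notin hk); rewrite inE.
rewrite dpl in ll; rewrite dpl jj in jl'; rewrite dpl kk in kl'.
clear pl dpl hl hj hk jj kk.
have [a0|a0] := ltP a 0.
  have : 0 < - a * (bk - dotp ck (p j)) by apply: mulr_gt0; lra.
  by lra.
have [a1|a1] := ltP 1 a.
  have : 0 < (a - 1) * (bj - dotp cj (p k)) by apply: mulr_gt0; lra.
  by lra.
have : 0 <= (1 - a) * (bl - dotp cl (p k)) by apply: mulr_ge0; lra.
move: a0; rewrite le_eqVlt => /predU1P[a0|a0]; first by move: ll; rewrite -a0; lra.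
have : 0 < a * (bl - dotp cl (p j)) by apply: mulr_gt0; lra.
by lra.
Qed.

(** The edge has a one-dimensional direction, so a third generator on it would be collinear with
    [p j] and [p k]. *)
Lemma adjacent_exposes j k : adjacent hull (p j) (p k) ->
  exists c b, exposes c b (pred2 j k).
Proof.
move=> [pjk _ _ [F [[[c [b [le_b eF]]] [_ [U [U_in _] dimU]]] Fj Fk]]].
have jk : j != k by apply: contra_notN pjk => /eqP->.
exists c, b => l; rewrite !inE.
have [->|lj] := eqVneq l j; first by move: Fj; rewrite eF => -[].
have [->|lk] := eqVneq l k; first by move: Fk; rewrite eF => -[].
rewrite /= lt_neqAle le_b ?andbT; last exact: hull_gen.
apply/eqP => cl.
have Fl : F (p l) by rewrite eF; split=> //; exact: hull_gen.
have defU : <[p j - p k]>%VS = U.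
  apply/eqP; rewrite eqEdim -memvE U_in //= dimU dim_vline.
  by rewrite subr_eq0; move/eqP: pjk => ->.
have /vlineP[a ea] : p l - p k \in <[p j - p k]>%VS by rewrite defU U_in.
apply: (vertices_not_collinear (a := a) jk lj lk).
by rewrite -ea addrC subrK.
Qed.

(** Every vertex met by a walk is a generator, so [f] gains at most one per step. Such an [f]
    certifies lower bounds on distances. *)
Lemma walk_potential (f : J -> nat) :
  (forall j k c b, exposes c b (pred2 j k) -> (f k <= (f j).+1)%N) ->
  forall n j k, walk hull n (p j) (p k) -> (f k <= f j + n)%N.
Proof.
move=> Lf; elim=> [|n IH] j k.
  by move=> [[|? ?] [//= _ /gen_inj-> _]]; rewrite addn0.
move=> /walkS[v jv vk]; have [_ _ /vertex_gen[i ei] _] := jv.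
move: jv vk; rewrite {}ei => /adjacent_exposes[c [b /Lf fi]] /IH fk.
by rewrite addnS -addSn; apply: leq_trans fk _; rewrite leq_add2r.
Qed.

Lemma hull_diameter (D : nat) (f : J -> nat) (j0 k0 : J) :
  (forall j k, exists2 n, walk hull n (p j) (p k) & (n <= D)%N) ->
  (forall j k c b, exposes c b (pred2 j k) -> (f k <= (f j).+1)%N) ->
  (f j0 + D <= f k0)%N ->
  has_diameter hull D.
Proof.
move=> short Lf far; split.
  move=> u v /vertex_gen[j ->] /vertex_gen[k ->].
  have [n /walk_dist[m dm mn] nD] := short j k.
  by exists m => //; exact: leq_trans nD.
exists (p j0), (p k0); split; [exact: gen_vertex..|].
have [n /walk_dist[m dm mn] nD] := short j0 k0.
suff -> : D = m by [].
apply/eqP; rewrite eqn_leq (leq_trans mn nD) andbT.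
have [wm _] := dm.
by rewrite -(leq_add2l (f j0)) (leq_trans far) // walk_potential.
Qed.

End Hull.

(** The product weights [w i * w' j] turn a sum of two combinations into one combination of the
    points [p i + q j]; conversely, a combination of the [r k] splits term by term. *)
Lemma minkowski_hull (R : realType) (d : nat) (I J K : finType)
    (p : I -> 'rV[R]_d) (q : J -> 'rV[R]_d) (r : K -> 'rV[R]_d) :
  (forall i j, hull r (p i + q j)) ->
  (forall k, exists i j, r k = p i + q j) ->
  minkowski_sum (hull p) (hull q) = hull r.
Proof.
move=> pq_r r_pq; apply/seteqP; split=> x.
  move=> [_ [w [w0 w1 ->]]] [_ [w' [w'0 w'1 ->]] <-].
  have -> : \sum_i w i *: p i + \sum_j w' j *: q j =
      \sum_(ij : I * J) (w ij.1 * w' ij.2) *: (p ij.1 + q ij.2).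
    rewrite -(pair_bigA _ (fun i j => (w i * w' j) *: (p i + q j))) /=.
    under [RHS]eq_bigr => i _ do under eq_bigr => j _ do rewrite scalerDr.
    under [RHS]eq_bigr => i _ do rewrite big_split /= -scaler_suml -mulr_sumr w'1 mulr1.
    rewrite big_split /=; congr (_ + _); rewrite exchange_big /=.
    apply: eq_bigr => j _.
    by rewrite -scaler_suml -mulr_suml w1 mul1r.
  apply: hull_comb => [ij||ij]; [exact: mulr_ge0| |exact: pq_r].
  rewrite -(pair_bigA _ (fun i j => w i * w' j)) /= -[RHS]w1.
  by apply: eq_bigr => i _; rewrite -mulr_sumr w'1 mulr1.
move=> [w [w0 w1 ->]].
have [s hs] := choice r_pq; have [s' hs'] := choice hs.
exists (\sum_k w k *: p (s k)).
  by apply: hull_comb => // k; exact: hull_gen.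
exists (\sum_k w k *: q (s' k)).
  by apply: hull_comb => // k; exact: hull_gen.
by rewrite -big_split; apply: eq_bigr => k _; rewrite hs' scalerDr.
Qed.

(** * Support values on the stacked simplices *)

Lemma sum_eq0_pos (R : realType) (I : finType) (x : I -> R) i :
  \sum_k x k = 0 -> x i < 0 -> exists k, 0 < x k.
Proof.
move=> x0 xi; apply: contrapT => /forallNP npos; move: x0.
rewrite (bigD1 i) //= => x0.
have : \sum_(k | k != i) x k <= 0.
  by apply: sumr_le0 => k _; rewrite leNgt; apply/negP.
by lra.
Qed.

Lemma sum_eqR (R : realType) (I : finType) (i : I) : \sum_k (k == i)%:R = 1 :> R.
Proof. by rewrite (bigD1 i) //= eqxx big1 ?addr0 // => k /negPf->. Qed.

Section Base.
Context {R : realType} {m l : nat}.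
Local Notation I := 'I_m.+2.
Local Notation T := 'I_l.+2.
Implicit Types (i : I) (t : T) (j : I * T) (x : I -> R).

(** Symmetric about 0, from [-(l+1)] to [l+1], so the bottom and top copies mirror each other. *)
Definition height (t : nat) : R := 2 * t%:R - l.+1%:R.

(** Quadratic in the height, so that support values compare by polynomial identities; the constant
    exceeds every squared height, which keeps it positive. *)
Definition radius (t : nat) : R := l.+2%:R ^+ 2 - height t ^+ 2.

(** The value at the base vertex [j] of the functional with value [x i] at the simplex vertex
    delta_i and slope [beta] along the height. *)
Definition level (x : I -> R) (beta : R) (j : I * T) : R :=
  radius j.2 * x j.1 + beta * height j.2.

Lemma height_ge t : - l.+1%:R <= height t.
Proof. by rewrite /height; have := ler0n R t; lra. Qed.

Lemma height_le t : height t <= l.+1%:R.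
Proof.
rewrite /height; have : (t : nat)%:R <= l.+1%:R :> R by rewrite ler_nat -ltnS.
by lra.
Qed.

Lemma radius_gt0 t : 0 < radius t.
Proof.
have := height_ge t; have := height_le t; rewrite /radius -[l.+2%:R]natr1.
move: (height t) (l.+1%:R) => y r yr ry.
have -> : (r + 1) ^+ 2 - y ^+ 2 = (r + 1 - y) * (r + 1 + y) by ring.
by apply: mulr_gt0; lra.
Qed.

Lemma height0 : height 0 = - l.+1%:R.
Proof. by rewrite /height mulr0 sub0r. Qed.

Lemma height_top : height l.+1 = l.+1%:R.
Proof. by rewrite /height; ring. Qed.

Lemma heightS (t : nat) : height t.+1 = height t + 2.
Proof. by rewrite /height -[t.+1%:R]natr1; ring. Qed.

Lemma radius0 : radius 0 = radius l.+1.
Proof. by rewrite /radius height0 height_top sqrrN. Qed.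

Lemma height_lt (s t : nat) : (height s < height t) = (s < t)%N.
Proof. by rewrite /height ltrD2r ltr_pM2l ?ltr_nat. Qed.

Lemma height_inj (s t : nat) : height s = height t -> s = t.
Proof.
move=> h; case: (ltngtP s t) => //; rewrite -height_lt h ltxx //.
Qed.

Lemma height_le_mono (s t : nat) : (height s <= height t) = (s <= t)%N.
Proof. by rewrite leNgt height_lt -leqNgt. Qed.

Definition spike i (k : I) : R := m.+2%:R * (k == i)%:R - 1.

Lemma sum_spike i : \sum_k spike i k = 0.
Proof.
by rewrite sumrB -mulr_sumr sum_eqR sumr_const card_ord mulr1 subrr.
Qed.

Lemma spike_eq i : spike i i = m.+1%:R.
Proof. by rewrite /spike eqxx mulr1 -[m.+2%:R]natr1 addrK. Qed.

Lemma spike_neq i k : k != i -> spike i k = -1.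
Proof. by rewrite /spike => /negPf->; rewrite mulr0 sub0r. Qed.

(** The slope is that of a tangent at [t]: on the ray [i] the level falls short of the maximum by
    [m.+1%:R * (height s - height t) ^+ 2]. *)
Lemma base_vertex j :
  exists x beta M, [/\ \sum_i x i = 0, 0 < M & peak (level x beta) M (pred1 j)].
Proof.
case: j => i t; exists (spike i), (m.+1%:R * (2 * height t)).
exists (m.+1%:R * (l.+2%:R ^+ 2 + height t ^+ 2)).
have m0 : 0 < m.+1%:R :> R by rewrite ltr0n.
split; first exact: sum_spike.
  by rewrite mulr_gt0 // ltr_wpDr ?sqr_ge0 // exprn_gt0 // ltr0n.
move=> [k s]; rewrite inE xpair_eqE /level /=.
have [->|ki] /= := eqVneq k i.
  rewrite spike_eq; have [->|st] := eqVneq s t; first by rewrite /radius; ring.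
  have hst : height s - height t != 0.
    by rewrite subr_eq0; apply: contra_neq st => /height_inj/val_inj.
  have : 0 < m.+1%:R * (height s - height t) ^+ 2.
    by rewrite mulr_gt0 // exprn_even_gt0 //= hst.
  by rewrite /radius; lra.
rewrite spike_neq //.
have rs := radius_gt0 s.
have : 0 < m.+1%:R * (radius s + (height s - height t) ^+ 2).
  by rewrite mulr_gt0 // ltr_wpDr ?sqr_ge0.
by move: rs; rewrite /radius; lra.
Qed.

(** A secant replaces the tangent: the shortfall on the ray [i] is a multiple of [(height s - height
    t) * (height s - height t')], positive elsewhere because no height lies strictly between two
    consecutive ones. *)
Lemma base_edge_vertical i t t' : t' = t.+1 :> nat ->
  exists x beta M,
    [/\ \sum_i x i = 0, 0 < M & peak (level x beta) M (pred2 (i, t) (i, t'))].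
Proof.
move=> tt'; exists (spike i), (m.+1%:R * (height t + height t')).
exists (m.+1%:R * (l.+2%:R ^+ 2 + height t * height t')).
have m0 : 0 < m.+1%:R :> R by rewrite ltr0n.
split; first exact: sum_spike.
  rewrite mulr_gt0 // tt' heightS.
  have : 2 <= l.+2%:R :> R by rewrite ler_nat.
  by nra.
have prod_gt0 (s : T) : s != t -> s != t' ->
    0 < (height s - height t) * (height s - height t').
  move=> st st'; have [lst|lts|/val_inj/eqP] := ltngtP s t; last by rewrite (negPf st).
  - rewrite nmulr_rgt0 subr_lt0 height_lt //.
    by rewrite tt' ltnS ltnW.
  - have lt's : (t' < s)%N.
      rewrite ltn_neqAle tt' lts andbT -tt'.
      by apply: contra_neq st' => t's; apply: val_inj.
    by rewrite mulr_gt0 // subr_gt0 height_lt.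
have prod_ge0 (s : T) : 0 <= (height s - height t) * (height s - height t').
  have [->|st] := eqVneq s t; first by rewrite subrr mul0r.
  have [->|st'] := eqVneq s t'; first by rewrite subrr mulr0.
  exact/ltW/prod_gt0.
move=> [k s]; rewrite !inE !xpair_eqE /level /=.
have [->|ki] /= := eqVneq k i.
  rewrite spike_eq.
  have [->|st] /= := eqVneq s t; first by rewrite /radius; ring.
  have [->|st'] /= := eqVneq s t'; first by rewrite /radius; ring.
  have : 0 < m.+1%:R * ((height s - height t) * (height s - height t')).
    by rewrite mulr_gt0 // prod_gt0.
  by rewrite /radius; lra.
rewrite spike_neq //.
have rs := radius_gt0 s.
have : 0 < m.+1%:R * (radius s + (height s - height t) * (height s - height t')).
  by rewrite mulr_gt0 // ltr_wpDr.
by move: rs; rewrite /radius; lra.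
Qed.

(** Only an end copy can be singled out by a steep slope in the height; within it,
    [spike i + spike i'] is largest exactly at [i] and [i']. *)
Lemma base_edge_horizontal i i' t : i != i' -> (t == ord0) || (t == ord_max) ->
  exists x beta M,
    [/\ \sum_i x i = 0, 0 < M & peak (level x beta) M (pred2 (i, t) (i', t))].
Proof.
move=> ii' t_end.
(* [e] is the sign of the end: [-1] at the bottom, [1] at the top. *)
have [e [e2 et e_lt]] : exists e : R, [/\ e * e = 1, e * height t = l.+1%:R
    & forall s : T, s != t -> e * height s <= l.+1%:R - 2].
  case/orP: t_end => /eqP-> /=; [exists (-1) | exists 1]; split.
  - by ring.
  - by rewrite height0; ring.
  - move=> s s0; have : (1 <= s)%N by rewrite lt0n.
    by rewrite -height_le_mono heightS height0; lra.
  - by ring.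
  - by rewrite height_top mul1r.
  - move=> s st; have : (s <= l)%N.
      rewrite -ltnS ltn_neqAle -ltnS ltn_ord andbT.
      by apply: contra_neq st => sl; apply: val_inj.
    by rewrite -height_le_mono -[X in _ <= X](addrK 2) -heightS height_top; lra.
have rt : radius t = l.+2%:R ^+ 2 - l.+1%:R ^+ 2.
  by rewrite /radius -et exprMn [e ^+ 2]e2 mul1r.
pose x k : R := spike i k + spike i' k.
(* Steep enough: leaving the end copy costs at least [2 * K], while the radial term is at most
   [m%:R * l.+2%:R ^+ 2], which is less than [K]. *)
pose K : R := m.+1%:R * l.+2%:R ^+ 2.
have xi k : (k == i) || (k == i') -> x k = m%:R.
  rewrite /x; case/orP => /eqP->; rewrite spike_eq spike_neq // -?[m.+1%:R]natr1.
  - by rewrite addrK.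
  - by rewrite addrC addrK.
  - by rewrite eq_sym.
have xn k : k != i -> k != i' -> x k = -2.
  by move=> ki ki'; rewrite /x !spike_neq //; ring.
have l0 : 0 <= l%:R :> R by [].
have m0 : 0 <= m%:R :> R by [].
have C0 : 0 < l.+2%:R ^+ 2 :> R by rewrite exprn_gt0 // ltr0n.
have rt0 := radius_gt0 t.
have K0 : 0 < K by rewrite mulr_gt0 // ltr0n.
exists x, (K * e), (radius t * m%:R + K * l.+1%:R); split.
- by rewrite big_split /= !sum_spike addr0.
- have : 0 < K * l.+1%:R by rewrite mulr_gt0 // ltr0n.
  by have := mulr_ge0 (ltW rt0) m0; lra.
move=> [k s]; rewrite !inE !xpair_eqE /level /= -mulrA.
have rs0 := radius_gt0 s.
have rsC : radius s <= l.+2%:R ^+ 2.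
  by rewrite /radius lerBlDr lerDl sqr_ge0.
have xm : x k <= m%:R.
  have [kS|] := boolP ((k == i) || (k == i')); first by rewrite xi.
  by rewrite negb_or => /andP[? ?]; rewrite xn //; lra.
have [->|st] := eqVneq s t.
  rewrite !andbT et; case: ifPn => [kS|]; first by rewrite xi.
  rewrite negb_or => /andP[? ?]; rewrite xn // ltrD2r ltr_pM2l //; lra.
rewrite !andbF /=.
have h1 : radius s * x k <= l.+2%:R ^+ 2 * m%:R.
  by apply: (le_trans (y := radius s * m%:R)); rewrite ?ler_pM2l ?ler_wpM2r.
have h2 : K * (e * height s) <= K * (l.+1%:R - 2) by rewrite ler_pM2l ?e_lt.
have h3 : 0 <= radius t * m%:R by rewrite mulr_ge0 // ltW.
have : K = m%:R * l.+2%:R ^+ 2 + l.+2%:R ^+ 2 by rewrite /K -natr1; ring.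
by lra.
Qed.

(** The potential for the lower bound on distances; it runs from 0 at [(ord0, ord0)] to [l + 2] at
    [(ord_max, ord_max)]. *)
Definition rank (j : I * T) : nat := j.2 + (j.1 != ord0).

Lemma rank_peak x beta M j j' : \sum_i x i = 0 ->
  peak (level x beta) M (pred2 j j') -> (rank j' <= (rank j).+1)%N.
Proof.
case: j j' => [i t] [i' t'] x0 pk; rewrite /rank /=.
have vt : level x beta (i, t) = M by apply: (peak_in pk); rewrite !inE eqxx.
have vt' : level x beta (i', t') = M.
  by apply: (peak_in pk); rewrite !inE eqxx orbT.
have rt := radius_gt0 t; have rt' := radius_gt0 t'.
have [ii'|ii'] := eqVneq i i'; last first.
  have [->|tt'] := eqVneq t t'; first by case: (i' != ord0) => /=; lia.
  (* Exchanging t and t' : a positive combination of the two points of the pair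
     equals one of (i, t') and (i', t), of the same total weight. *)
  have v1 : level x beta (i, t') < M.
    by apply: (peak_notin pk); rewrite !inE !xpair_eqE eq_sym (negPf tt') (negPf ii') andbF.
  have v2 : level x beta (i', t) < M.
    apply: (peak_notin pk).
    by rewrite !inE !xpair_eqE (negPf tt') eq_sym (negPf ii') andbF.
  have : radius t' * level x beta (i, t) + radius t * level x beta (i', t') =
      radius t * level x beta (i, t') + radius t' * level x beta (i', t).
    by rewrite /level /radius /=; ring.
  have := mulr_gt0 rt (y := M - level x beta (i, t')); rewrite subr_gt0 => /(_ v1).
  have := mulr_gt0 rt' (y := M - level x beta (i', t)); rewrite subr_gt0 => /(_ v2).
  by rewrite vt vt'; lra.
rewrite -{}ii' in vt' pk *; rewrite -addSn leq_add2r leqNgt; apply/negP => tt'.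
have tT : (t.+1 < l.+2)%N by exact: leq_ltn_trans (ltnW tt') (ltn_ord t').
have vs : level x beta (i, Ordinal tT) < M.
  apply: (peak_notin pk); rewrite !inE !xpair_eqE eqxx /= -!val_eqE /=.
  by rewrite gtn_eqF // ltn_eqF.
have ab : height t < height t.+1 by rewrite height_lt.
have bc : height t.+1 < height t' by rewrite height_lt.
(* By concavity the ray i bulges out between t and t', so x i < 0; but then
   some other ray beats the ray i on the copy t. *)
have xi : x i < 0.
  move: vs vt vt'; rewrite /level /radius /=.
  (* For heights [a < b < c] with value [M] at [a] and [c], the level at [b] is
     [M + x i * (c - b) * (b - a)]. *)
  move: (height t) (height t.+1) (height t') (l.+2%:R ^+ 2) ab bc => a b c C ab bc.
  move=> vs va vc; rewrite ltNge; apply/negP => xi.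
  have : 0 <= x i * ((c - b) * (b - a) * (c - a)).
    by apply: mulr_ge0 => //; apply: mulr_ge0; [apply: mulr_ge0|]; lra.
  have : 0 < (c - a) * (M - ((C - b ^+ 2) * x i + beta * b)) by apply: mulr_gt0; lra.
  have := congr1 (fun z => (c - b) * z) va; have := congr1 (fun z => (b - a) * z) vc.
  by rewrite /=; lra.
have [k xk] := sum_eq0_pos x0 xi.
have := peak_le pk (k, t); rewrite -vt /level /= lerD2r ler_pM2l //.
by move: xk xi; lra.
Qed.

End Base.

(** * The pyramids and their Minkowski sum *)

Section Points.
Context {R : realType} {m : nat}.
Local Notation I := 'I_m.+2.
Implicit Types (i : I) (x : I -> R).

(** The standard basis vectors, and minus their sum for [ord_max]. *)
Definition corner i : 'rV[R]_m.+1 :=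
  \row_k ((k == i :> nat)%:R - (i == ord_max)%:R).

Lemma sum_corner : \sum_i corner i = 0.
Proof.
apply/rowP => k; rewrite summxE mxE.
under eq_bigr => i _ do rewrite mxE.
rewrite sumrB [X in _ - X]sum_eqR (bigD1 (widen_ord (leqnSn _) k)) //= eqxx big1.
  by rewrite addr0 subrr.
move=> i ik; case: eqP => // ki; case/eqP: ik; apply: val_inj => /=.
by rewrite ki.
Qed.

(** The first corners form a basis, so their values can be prescribed; the zero sum then forces the
    value at the last one. *)
Lemma corner_functional x : \sum_i x i = 0 ->
  exists xi : 'rV[R]_m.+1, forall i, dotp xi (corner i) = x i.
Proof.
rewrite big_ord_recr /= => x0; exists (\row_k x (widen_ord (leqnSn _) k)) => i.
rewrite /dotp; under eq_bigr => k _ do rewrite !mxE mulrBr.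
rewrite sumrB -mulr_suml.
have [->|i_max] := eqVneq i ord_max.
  rewrite mulr1 big1 => [|k _]; first by rewrite sub0r; lra.
  by rewrite ltn_eqF ?mulr0 //=.
have im : (i < m.+1)%N.
  rewrite ltn_neqAle -ltnS ltn_ord andbT.
  by apply: contra_neq i_max => im; apply: val_inj.
rewrite mulr0 subr0 (bigD1 (Ordinal im)) //= eqxx mulr1 big1.
  by rewrite addr0; congr (x _); apply: val_inj.
move=> k ki; rewrite (_ : (k == i :> nat) = false) ?mulr0 //.
by apply: contra_neqF ki => /eqP ki; apply: val_inj.
Qed.

(* [1 + (1 + m.+1)] is convertible to [m.+3], which lets [row_mx] be used; the
   distinguished coordinates z (apex direction) and y (height) come first. *)
Definition ray_point i (a y z : R) : 'rV[R]_m.+3 :=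
  row_mx z%:M (row_mx y%:M (a *: corner i)) : 'rV[R]_(1 + (1 + m.+1)).

Lemma ray_pointD i a y z a' y' z' :
  ray_point i a y z + ray_point i a' y' z' = ray_point i (a + a') (y + y') (z + z').
Proof. by rewrite /ray_point (@add_row_mx _ 1 1 (1 + m.+1)) add_row_mx -!raddfD scalerDl. Qed.

Lemma ray_pointZ i b a y z : b *: ray_point i a y z = ray_point i (b * a) (b * y) (b * z).
Proof.
by rewrite /ray_point (@scale_row_mx _ 1 1 (1 + m.+1)) scale_row_mx !scale_scalar_mx scalerA.
Qed.

Lemma ray_point0 i i' y z : ray_point i 0 y z = ray_point i' 0 y z.
Proof. by rewrite /ray_point !scale0r. Qed.

Lemma ray_point00 i : ray_point i 0 0 0 = 0.
Proof. by rewrite /ray_point !raddf0 scale0r row_mx0 (@row_mx0 _ 1 1 (1 + m.+1)). Qed.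

Lemma sum_ray_point a : \sum_i ray_point i a 0 0 = 0.
Proof.
have -> : \sum_i ray_point i a 0 0 =
    row_mx 0 (row_mx 0 (a *: \sum_i corner i)) :> 'rV[R]_(1 + (1 + m.+1)).
  rewrite scaler_sumr; elim/big_rec2: _ => [|i u v _ ->].
    by rewrite row_mx0 (@row_mx0 _ 1 1 (1 + m.+1)).
  rewrite /ray_point !raddf0 (@add_row_mx _ 1 1 (1 + m.+1)) add_row_mx !add0r //.
by rewrite sum_corner scaler0 row_mx0 (@row_mx0 _ 1 1 (1 + m.+1)).
Qed.

Lemma dotp_ray_point (gamma beta : R) (xi : 'rV[R]_m.+1) i a y z :
  dotp (row_mx gamma%:M (row_mx beta%:M xi) : 'rV[R]_(1 + (1 + m.+1))) (ray_point i a y z) =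
  a * dotp xi (corner i) + beta * y + gamma * z.
Proof.
rewrite (@dotp_row_mx R 1 (1 + m.+1)) dotp_row_mx dotpZr.
by rewrite {1 2}/dotp !big_ord1 !mxE eqxx !mulr1n; ring.
Qed.

Lemma functional_exists x (beta gamma : R) : \sum_i x i = 0 ->
  exists c, forall i a y z, dotp c (ray_point i a y z) = a * x i + beta * y + gamma * z.
Proof.
move=> /corner_functional[xi exi].
exists (row_mx gamma%:M (row_mx beta%:M xi) : 'rV[R]_(1 + (1 + m.+1))).
by move=> i a y z; rewrite dotp_ray_point exi.
Qed.

(** With [functional_exists], this trades functionals for triples [x], [beta], [gamma] with [x] of
    zero sum. *)
Lemma functional_elim (c : 'rV[R]_m.+3) :
  exists x beta gamma, \sum_i x i = 0 /\
    forall i a y z, dotp c (ray_point i a y z) = a * x i + beta * y + gamma * z.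
Proof.
pose c' : 'rV[R]_(1 + (1 + m.+1)) := c.
exists (fun i => dotp (rsubmx (rsubmx c')) (corner i)).
exists (lsubmx (rsubmx c') 0 0), (lsubmx c' 0 0); split.
  by rewrite -dotp_sumr sum_corner dotp0r.
move=> i a y z; rewrite -dotp_ray_point -!mx11_scalar.
by rewrite hsubmxK (@hsubmxK _ 1 1 (1 + m.+1)).
Qed.

Lemma ray_point_span (V : {vspace 'rV[R]_m.+3}) :
  (forall i, ray_point i 1 0 0 \in V) -> ray_point ord0 0 1 0 \in V ->
  ray_point ord0 0 0 1 \in V -> V = fullv.
Proof.
move=> Vx Vy Vz; apply/eqP; rewrite eqEsubv subvf; apply/subvP => u _.
pose u' : 'rV[R]_(1 + (1 + m.+1)) := u.
(* The last corner is outside the basis and gets the coefficient 0. *)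
pose a (i : I) : R := if insub (i : nat) is Some k then rsubmx (rsubmx u') 0 k else 0.
suff -> : u = \sum_i a i *: ray_point i 1 0 0 +
    (lsubmx (rsubmx u') 0 0 *: ray_point ord0 0 1 0 + lsubmx u' 0 0 *: ray_point ord0 0 0 1).
  rewrite rpredD ?rpred_sum ?rpredD ?rpredZ // => i _; exact: rpredZ.
have -> : \sum_i a i *: ray_point i 1 0 0 =
    row_mx 0 (row_mx 0 (rsubmx (rsubmx u'))) :> 'rV[R]_(1 + (1 + m.+1)).
  transitivity (row_mx 0 (row_mx 0 (\sum_i a i *: corner i)) : 'rV[R]_(1 + (1 + m.+1))).
    elim/big_rec2: _ => [|i v w _ ->].
      by rewrite row_mx0 (@row_mx0 _ 1 1 (1 + m.+1)).
    rewrite ray_pointZ /ray_point !mulr0 mulr1 !raddf0.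
    by rewrite (@add_row_mx _ 1 1 (1 + m.+1)) add_row_mx !add0r.
  congr (row_mx 0 (row_mx 0 _)); apply/rowP => k; rewrite summxE.
  rewrite (bigD1 (widen_ord (leqnSn _) k)) //= !mxE big1 => [|i ik].
    rewrite addr0 /a /= eqxx insubT //= => kP; rewrite -val_eqE /= ltn_eqF // subr0 mulr1.
    by rewrite !mxE; congr (u' _ (rshift _ (rshift _ _))); apply: val_inj.
  rewrite !mxE /a; case: insubP => [k' _ ek'|]; last by rewrite mul0r.
  rewrite (_ : (k == i :> nat) = false) /=; last first.
    by apply: contra_neqF ik => /eqP ki; apply: val_inj; rewrite /= ki.
  by rewrite -val_eqE /= -ek' ltn_eqF //= subrr mulr0.
rewrite !ray_pointZ ray_pointD /ray_point !mulr0 !mulr1 !addr0 add0r scale0r.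
rewrite (@add_row_mx _ 1 1 (1 + m.+1)) add_row_mx !add0r addr0 -!mx11_scalar.
by rewrite hsubmxK (@hsubmxK _ 1 1 (1 + m.+1)).
Qed.

(** Midpoints of mirror points give a simplex at height 0, whose barycentre is the origin. *)
Lemma hull_origin (J : finType) (p : J -> 'rV[R]_m.+3) (a y : R) :
  (forall i, hull p (ray_point i a y 0)) -> (forall i, hull p (ray_point i a (- y) 0)) ->
  hull p 0.
Proof.
move=> hy hNy.
have h0 i : hull p (ray_point i a 0 0).
  have := hull_midpoint (hy i) (hNy i); rewrite !ray_pointZ ray_pointD.
  by congr (hull p (ray_point i _ _ _)); lra.
rewrite -(scaler0 _ m.+2%:R^-1) -(sum_ray_point a) scaler_sumr.
apply: hull_comb => [k||//]; first by rewrite invr_ge0.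
by rewrite sumr_const card_ord -[LHS]mulr_natr mulVf // pnatr_eq0.
Qed.

End Points.

(** * The two pyramids, and the truncated bipyramid that is their sum *)

Section Construction.
Context {R : realType} {m l : nat}.
Local Notation I := 'I_m.+2.
Local Notation T := 'I_l.+2.
Local Notation J := ('I_m.+2 * 'I_l.+2)%type.
Local Notation height := (@height R l).
Local Notation radius := (@radius R l).
Local Notation level := (@level R m l).
Implicit Types (i : I) (t : T) (j : J).

Definition base_point j (a z : R) : 'rV[R]_m.+3 :=
  ray_point j.1 (a * radius j.2) (a * height j.2) z.

Lemma base_functional x (beta gamma : R) : \sum_i x i = 0 ->
  exists c, [/\ forall j a z, dotp c (base_point j a z) = a * level x beta j + gamma * z
              & forall z, dotp c (ray_point ord0 0 0 z) = gamma * z].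
Proof.
move=> /(functional_exists beta gamma)[c ec]; exists c; split=> *; rewrite ec /level /=; ring.
Qed.

Lemma base_functional_elim c : exists x (beta gamma : R),
  \sum_i x i = 0 /\
  forall j a z, dotp c (base_point j a z) = a * level x beta j + gamma * z.
Proof.
have [x [beta [gamma [x0 ec]]]] := functional_elim c.
by exists x, beta, gamma; split=> // j a z; rewrite ec /level /=; ring.
Qed.

Definition pyramid (e : R) (o : option J) : 'rV[R]_m.+3 :=
  if o is Some j then base_point j 1 0 else ray_point ord0 0 0 e.

Lemma hull_origin_base (K : finType) (p : K -> 'rV[R]_m.+3) (a : R) :
  (forall j, hull p (base_point j a 0)) -> hull p 0.
Proof.
move=> hp; apply: (@hull_origin _ _ _ _ (a * radius 0) (a * height 0)) => i.
  exact: (hp (i, ord0)).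
by rewrite radius0 -mulrN height0 opprK -height_top; exact: (hp (i, ord_max)).
Qed.

(** Since 0 lies in the pyramid, the direction contains every generator. Bottom plus top copy yields
    the radial vectors, a base vertex then the height axis, and the apex the last axis. *)
Lemma pyramid_full_dim e : e != 0 -> has_dim (hull (pyramid e)) m.+3.
Proof.
move=> e0; have h0 : hull (pyramid e) 0.
  by apply: (@hull_origin_base _ _ 1) => j; exact: (hull_gen (pyramid e) (Some j)).
split; first by exists 0.
exists fullv; last by rewrite dimvf /dim /= mul1n.
split=> [x y _ _|V HV]; first exact: memvf.
suff -> : V = fullv by exact: subvv.
have HVp o : pyramid e o \in V.
  by rewrite -[pyramid e o]subr0; apply: HV => //; exact: hull_gen.
have Vx i : ray_point i 1 0 0 \in V.
  have r0 : radius 0 != 0 by rewrite gt_eqF // (radius_gt0 (ord0 : T)).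
  have -> : ray_point i 1 0 0 = (2 * radius 0)^-1 *:
      (pyramid e (Some (i, ord0)) + pyramid e (Some (i, ord_max))).
    rewrite /pyramid /base_point ray_pointD ray_pointZ /= -radius0 height0 height_top.
    congr ray_point; by [field | ring].
  by rewrite rpredZ // rpredD.
apply: ray_point_span => //.
  have -> : ray_point ord0 0 1 0 = l.+1%:R^-1 *:
      (pyramid e (Some (ord0, ord_max)) - radius l.+1 *: ray_point ord0 1 0 0).
    rewrite /pyramid /base_point -scaleN1r !ray_pointZ ray_pointD ray_pointZ /= height_top.
    by congr ray_point; try ring; rewrite mulrDr mul1r !mulr0 addr0 mulVf ?pnatr_eq0.
  by rewrite rpredZ // rpredB // rpredZ.
have -> : ray_point ord0 0 0 1 = e^-1 *: pyramid e None.
  by rewrite /= ray_pointZ !mulr0 mulVf.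
by rewrite rpredZ.
Qed.

(** The apex is exposed by its own axis. A base vertex is exposed by a functional vanishing on that
    axis; [M > 0] keeps the apex below it. *)
Lemma pyramid_exposed e : e * e = 1 -> forall o, exists c b, exposes (pyramid e) c b (pred1 o).
Proof.
move=> ee [j|]; last first.
  have [|c [ec ec']] := @base_functional (fun=> 0) 0 e; first by rewrite big1.
  exists c, 1 => -[k|]; rewrite inE /= ?ec ?ec' //.
  by rewrite /level !mulr0 !mul0r !addr0 mulr0.
have [x [beta [M [x0 M0 pk]]]] := @base_vertex R m l j.
have [c [ec ec']] := base_functional beta 0 x0.
exists c, M => -[k|]; rewrite inE /= ?ec ?ec' mul0r // ?addr0 ?mul1r.
exact: pk k.
Qed.

(** Tilting a functional that exposes [j] in the base by [M * e] lifts the apex to the same value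
    [M]. *)
Lemma pyramid_adjacent e j : e * e = 1 ->
  adjacent (hull (pyramid e)) (pyramid e (Some j)) (pyramid e None).
Proof.
move=> ee; have [x [beta [M [x0 M0 pk]]]] := @base_vertex R m l j.
have [c [ec ec']] := base_functional beta (M * e) x0.
apply: (@exposes_adjacent _ _ _ _ (pyramid_exposed ee) c M) => // -[k|].
  by have := pk k; rewrite !inE orbF /= ec mulr0 addr0 mul1r.
by rewrite !inE /= ec' -mulrA ee mulr1.
Qed.

Lemma pyramid_diameter e : e * e = 1 -> has_diameter (hull (pyramid e)) 2.
Proof.
move=> ee; pose far : J := (ord_max, ord_max).
pose f (o : option J) : nat :=
  if o is Some j then (if j == far then 2 else (j != (ord0, ord0)))%N else 1%N.
apply: (@hull_diameter _ _ _ _ (pyramid_exposed ee) 2 f (Some (ord0, ord0)) (Some far)) => //.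
  have w j := walk1 (pyramid_adjacent j ee).
  move=> [j|] [k|].
  - by exists 2 => //; exact: walk_trans (w j) (walk_sym (w k)).
  - by exists 1.
  - by exists 1 => //; exact: walk_sym.
  - by exists 0; [exact: walk0|].
move=> [j|] [k|] c b pk //=; last by case: ifP => // _; case: eqP.
case: (eqVneq k far) => [kf|_]; last by case: (k != _).
case: (eqVneq j far) => // _; case: (eqVneq j (ord0, ord0)) => // j0.
(* Only an edge between the two extreme base vertices could break the bound; it would be an edge of
   the base raising [rank] from 0 to [l + 2]. *)
have [x [beta [gamma [x0 ec]]]] := base_functional_elim c.
have /(rank_peak x0) : peak (level x beta) b (pred2 j k).
  move=> i; have := pk (Some i); rewrite !inE /= ec mulr0 addr0 mul1r.
  by [].
by rewrite kf j0 /rank /= addn1.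
by rewrite /f !eqxx.
Qed.

(* [None] is the equator and [Some true], [Some false] the two truncations. *)
Definition apex_level (s : option bool) : R :=
  if s is Some b then (if b then 1 else -1) else 0.

Definition layer_scale (s : option bool) : R := if s is Some _ then 1 else 2.

Definition truncated_bipyramid (u : J * option bool) : 'rV[R]_m.+3 :=
  base_point u.1 (layer_scale u.2) (apex_level u.2).

Local Notation bipyr := truncated_bipyramid.

(** Base plus base is a midpoint of doubled base points, apex plus base is a truncation vertex, and
    the two apexes cancel to the origin, which is inside. *)
Lemma minkowski_pyramids :
  minkowski_sum (hull (pyramid 1)) (hull (pyramid (-1))) = hull bipyr.
Proof.
have half j : base_point j 1 0 = 2^-1 *: bipyr (j, None).
  by rewrite /bipyr /base_point ray_pointZ /=; congr ray_point; field.
have apex j b : base_point j 1 0 + ray_point ord0 0 0 (apex_level (Some b)) =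
      bipyr (j, Some b).
  rewrite /bipyr /base_point (ray_point0 ord0 j.1) ray_pointD /=.
  by congr ray_point; rewrite ?addr0 ?add0r.
apply: minkowski_hull => [[j|] [k|] /=|[j [[]|]]].
- by rewrite !half; apply: hull_midpoint; exact: hull_gen.
- by rewrite (apex j false); exact: hull_gen.
- by rewrite addrC (apex k true); exact: hull_gen.
- rewrite ray_pointD !addr0 subrr ray_point00.
  by apply: (@hull_origin_base _ _ 2) => j; exact: (hull_gen bipyr (j, None)).
- by exists None, (Some j); rewrite addrC /= -(apex j true).
- by exists (Some j), None; rewrite /= -(apex j false).
- exists (Some j), (Some j) => /=; rewrite half -scalerDr -mulr2n -scaler_nat scalerA.
  by rewrite mulVf ?scale1r // pnatr_eq0.
Qed.

(** With tilt [2 * M], the vertex of a truncation reaches [3 * M] against [2 * M] on the equator;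
    without tilt, the doubled equator wins by [2 * M] against [M]. *)
Lemma bipyramid_exposed u : exists c b, exposes bipyr c b (pred1 u).
Proof.
case: u => j s; have [x [beta [M [x0 M0 pk]]]] := @base_vertex R m l j.
have [c [ec _]] := base_functional beta (2 * M * apex_level s) x0.
exists c, (layer_scale s * M + 2 * M * apex_level s * apex_level s).
move=> [k r]; rewrite inE xpair_eqE /bipyr /= ec.
have := pk k; rewrite inE; case: eqP => _ /= vk; last first.
  by case: r => [[]|]; case: (s) => [[]|] /=; lra.
by rewrite vk; case: r => [[]|]; case: (s) => [[]|] /=; lra.
Qed.

Lemma bipyramid_equator_adjacent x beta M j k : j != k ->
  \sum_i x i = 0 -> 0 < M -> peak (level x beta) M (pred2 j k) ->
  adjacent (hull bipyr) (bipyr (j, None)) (bipyr (k, None)).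
Proof.
move=> jk x0 M0 pk; have [c [ec _]] := base_functional beta 0 x0.
apply: (exposes_adjacent bipyramid_exposed (c := c) (b := 2 * M)).
  move=> [i s]; rewrite !inE !xpair_eqE /bipyr /= ec mul0r addr0.
  have := pk i; rewrite !inE -andb_orl; case: (_ || _) => /= vi; last first.
    by case: s => [b|] /=; lra.
  by rewrite vi; case: s => [b|] /=; lra.
by rewrite xpair_eqE (negPf jk).
Qed.

(** The tilt [M] balances the two layers: both copies of [j] reach [2 * M], the opposite copy only
    0. *)
Lemma bipyramid_vertical_adjacent j b :
  adjacent (hull bipyr) (bipyr (j, None)) (bipyr (j, Some b)).
Proof.
have [x [beta [M [x0 M0 pk]]]] := @base_vertex R m l j.
have [c [ec _]] := base_functional beta (M * apex_level (Some b)) x0.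
apply: (exposes_adjacent bipyramid_exposed (c := c) (b := 2 * M)); last first.
  by rewrite xpair_eqE andbF.
move=> [i s]; rewrite !inE !xpair_eqE /bipyr /= ec -andb_orr.
have := pk i; rewrite inE; case: eqP => _ /= vi; last first.
  by case: s => [[]|]; case: (b) => /=; lra.
by rewrite vi; case: s => [[]|]; case: (b) => /=; lra.
Qed.

(** * Short walks on the truncated bipyramid *)

Lemma walk_same_ray i t t' : (t <= t')%N ->
  walk (hull bipyr) (t' - t) (bipyr ((i, t), None)) (bipyr ((i, t'), None)).
Proof.
move: {2}(t' - t)%N (erefl (t' - t)%N) => n; elim: n t' => [|n IH] t' en tt'.
  have -> : t' = t by apply: val_inj => /=; lia.
  by rewrite subnn; exact: walk0.
have sT : (t'.-1 < l.+2)%N by have := ltn_ord t'; lia.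
pose s := Ordinal sT.
have ts : t' = s.+1 :> nat by rewrite /=; lia.
have [x [beta [M [x0 M0 pk]]]] := @base_edge_vertical R m l i s t' ts.
rewrite (_ : (t' - t = (s - t) + 1)%N); last by rewrite /=; lia.
apply: walk_trans (IH s _ _) _; rewrite /=; [lia|lia|].
apply/walk1/(bipyramid_equator_adjacent _ x0 M0 pk).
by rewrite xpair_eqE eqxx -val_eqE /=; lia.
Qed.

(* With truncated subtraction the length is |t - t'|. *)
Lemma walk_same_ray_sym i t t' :
  walk (hull bipyr) (t' - t + (t - t')) (bipyr ((i, t), None)) (bipyr ((i, t'), None)).
Proof.
case: (leqP t t') => [tt'|/ltnW t't].
  by rewrite (eqP tt') addn0; exact: walk_same_ray.
by rewrite (eqP t't) add0n; apply: walk_sym; exact: walk_same_ray.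
Qed.

Lemma walk_horizontal i i' t : i != i' -> (t == ord0) || (t == ord_max) ->
  walk (hull bipyr) 1 (bipyr ((i, t), None)) (bipyr ((i', t), None)).
Proof.
move=> ii' t_end.
have [x [beta [M [x0 M0 pk]]]] := @base_edge_horizontal R m l _ _ _ ii' t_end.
apply/walk1/(bipyramid_equator_adjacent _ x0 M0 pk).
by rewrite xpair_eqE (negPf ii').
Qed.

(* The two routes through the ends [ord0] and [ord_max] have total length 2 (l + 2). *)
Lemma walk_equator j k : exists2 n,
  walk (hull bipyr) n (bipyr (j, None)) (bipyr (k, None)) & (n <= l.+2)%N.
Proof.
case: j k => [i t] [i' t']; have := ltn_ord t; have := ltn_ord t'.
move=> tl t'l; have [<-|ii'] := eqVneq i i'.
  by eexists; [exact: walk_same_ray_sym | lia].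
have via (s : T) : (s == ord0) || (s == ord_max) ->
    walk (hull bipyr) ((s - t + (t - s)) + 1 + (t' - s + (s - t')))
      (bipyr ((i, t), None)) (bipyr ((i', t'), None)).
  move=> s_end; apply: walk_trans (walk_same_ray_sym i' s t').
  exact: walk_trans (walk_same_ray_sym i t s) (walk_horizontal ii' s_end).
case: (leqP (t + t') l.+1) => tt'.
  by exists (0 - t + (t - 0) + 1 + (t' - 0 + (0 - t')))%N; [exact: (via ord0)|lia].
exists (l.+1 - t + (t - l.+1) + 1 + (t' - l.+1 + (l.+1 - t')))%N; last by lia.
by apply: (via ord_max); rewrite eqxx orbT.
Qed.

Lemma walk_bipyramid u v : exists2 n,
  walk (hull bipyr) n (bipyr u) (bipyr v) & (n <= l.+4)%N.
Proof.
case: u v => [j s] [k r]; have [n wn nl] := walk_equator j k.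
have down (i : J) q : exists2 e,
      walk (hull bipyr) e (bipyr (i, None)) (bipyr (i, q)) & (e <= 1)%N.
  case: q => [b|]; last by exists 0; [exact: walk0|].
  by exists 1 => //; apply/walk1/bipyramid_vertical_adjacent.
have [e we e1] := down j s; have [e' we' e'1] := down k r.
exists (e + n + e')%N; last by lia.
exact: walk_trans (walk_trans (walk_sym we) wn) we'.
Qed.

(** * The lower bound on its diameter *)

Definition layer_rank (s : option bool) : nat :=
  if s is Some b then (if b then 2 else 0) else 1.

Lemma bipyramid_rank u v c b : exposes bipyr c b (pred2 u v) ->
  (rank v.1 + layer_rank v.2 <= (rank u.1 + layer_rank u.2).+1)%N.
Proof.
case: u v => [j s] [k r] pk /=.
have [x [beta [gamma [x0 ec]]]] := base_functional_elim c.
have val (i : J) q :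
    dotp c (bipyr (i, q)) = layer_scale q * level x beta i + gamma * apex_level q.
  by rewrite ec.
have b0 : 0 <= b.
  rewrite -(dotp0r c); apply: (hull_le (p := bipyr)); first exact: exposes_le pk.
  by apply: (@hull_origin_base _ _ 2) => i; exact: (hull_gen bipyr (i, None)).
have vj : dotp c (bipyr (j, s)) = b by apply: (exposes_in pk); rewrite !inE eqxx.
have vk : dotp c (bipyr (k, r)) = b by apply: (exposes_in pk); rewrite !inE eqxx orbT.
have lt_b (i : J) q : (i, q) != (j, s) -> (i, q) != (k, r) -> dotp c (bipyr (i, q)) < b.
  by move=> ij ik; apply: (exposes_notin pk); rewrite !inE negb_or ij.
(* Within one layer, removing the constant tilt and rescaling leaves an edge of the base. *)
have [sr|sr] := eqVneq s r.
  rewrite -sr -addSn leq_add2r.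
  have ls : 0 < layer_scale s by rewrite /layer_scale; case: (s).
  suff : peak (level x beta) ((b - gamma * apex_level s) / layer_scale s) (pred2 j k).
    exact: rank_peak.
  move=> i; have := pk (i, s); rewrite !inE !xpair_eqE -sr eqxx !andbT val.
  case: (_ || _) => vi; last by rewrite ltr_pdivlMr //; lra.
  by apply: (mulIf (lt0r_neq0 ls)); rewrite mulfVK ?lt0r_neq0 //; lra.
(* Over one base vertex, only the jump from the lower to the upper truncation must be excluded: the
   equator copy is the sum of the two, so its value is [2 * b], not below [b] as [b >= 0]. *)
have [kj|jk] := eqVneq k j.
  have := lt_b j None; move: vj vk sr; rewrite kj !val !xpair_eqE.
  case: s {lt_b pk} => [[]|]; case: r => [[]|] //=; rewrite ?andbF ?addn0; try by lia.
  by move=> vj vk _ /(_ isT isT) lj; exfalso; lra.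
(* If both components change, the layer [s] puts [level x beta j] above [level x beta k] and the
   layer [r] puts it below. *)
have ljr : dotp c (bipyr (j, r)) < b.
  apply: lt_b; rewrite xpair_eqE ?(eq_sym r) ?(negPf sr) ?andbF //.
  by rewrite eq_sym (negPf jk).
have lks : dotp c (bipyr (k, s)) < b.
  by apply: lt_b; rewrite xpair_eqE ?(negPf sr) ?andbF // (negPf jk).
exfalso; move: vj vk ljr lks sr; rewrite !val.
by case: s {lt_b pk} => [b1|]; case: r => [b2|] //= *; lra.
Qed.

Lemma bipyramid_diameter : has_diameter (hull bipyr) l.+4.
Proof.
apply: (@hull_diameter _ _ _ _ bipyramid_exposed _
  (fun u => rank u.1 + layer_rank u.2)%N ((ord0, ord0), Some false)
  ((ord_max, ord_max), Some true)).
- exact: walk_bipyramid.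
- exact: bipyramid_rank.
- by rewrite /rank /=; lia.
Qed.

End Construction.

Theorem proposition3p3 (R : realType) (d k : nat) (hd : (3 <= d)%N)
    (hk : (4 <= k)%N) :
  exists P Q : set 'rV[R]_d,
    [/\ is_polytope P /\ has_dim P d,
        is_polytope Q /\ has_dim Q d,
        has_diameter P 2,
        has_diameter Q 2
      & has_diameter (minkowski_sum P Q) k].
Proof.
(* With [d = m + 3] and [k = l + 4], the base stacks [l + 2] simplices of dimension [m + 1]. *)
case: d hd => [|[|[|m]]] // _; case: k hk => [|[|[|[|l]]]] // _.
exists (hull (@pyramid R m l 1)), (hull (@pyramid R m l (-1))); split.
- by split; [exact: hull_polytope | apply: pyramid_full_dim; rewrite oner_eq0].
- split; first exact: hull_polytope.
  by apply: pyramid_full_dim; rewrite oppr_eq0 oner_eq0.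
- by apply: pyramid_diameter; rewrite mulr1.
- by apply: pyramid_diameter; rewrite mulrNN mulr1.
- by rewrite minkowski_pyramids; exact: bipyramid_diameter.
Qed.
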